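(* Let $A,G,Q,\Gamma\in\mathbb{R}^{n\times n}$, $B\in\mathbb{R}^{n\times m}$, $R\in\mathbb{R}^{m\times m}$ with $Q,R$ symmetric, and let $0<\gamma<1$. Suppose Assumption 1 (stated in the context) holds, and let $K_0\in\mathbb{R}^{m\times n}$ be a $\gamma$-stabilizer of $(A,B)$, i.e. $\sqrt{\gamma}(A-BK_0)$ is Schur. For $k=0,1,2,\dots$ let $P_k\in\mathbb{R}^{n\times n}$ (symmetric) and $K_{k+1}\in\mathbb{R}^{m\times n}$ be solutions of $$P_k=\gamma A_k^{T}P_kA_k+K_k^{T}RK_k+Q,\qquad A_k:=A-BK_k,$$ $$K_{k+1}=\gamma(R+\gamma B^{T}P_kB)^{-1}B^{T}P_kA .$$ Let $P$ be the stabilizing solution of the algebraic Riccati equation $$P=\gamma A^{T}PA-\gamma^{2}A^{T}PB(R+\gamma B^{T}PB)^{-1}B^{T}PA+Q,$$ and let $K=\gamma(R+\gamma B^{T}PB)^{-1}B^{T}PA$. If, in addition, either Assumption 3 or Assumption 4 (both stated in the context) is satisfied, then: (a) for all $k\ge 0$, $\sqrt{\gamma}A_k$ is Schur; (b) $P_k\ge P_{k+1}\ge P$ for all $k\ge 0$; (c) $\lim_{k\to\infty}P_k=P$ and $\lim_{k\to\infty}K_k=K$.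
   Context: Setting. There are $N$ agents with states $x_{ik}\in\mathbb{R}^n$ and inputs $u_{ik}\in\mathbb{R}^m$ ($1\le i\le N$, time $k\ge0$) obeying $x_{i(k+1)}=Ax_{ik}+Gx_k^{(N)}+Bu_{ik}+Dw_{ik}$, where $x_k^{(N)}=\frac1N\sum_{i=1}^N x_{ik}$ and $w_{ik}$ are independent white noises with zero mean and variance $\sigma^2$. Assumption 1. The initial states $\{x_{i0}\}_{i=1}^N$ are mutually independent and independent of the noises $\{w_i\}_{i=1}^N$; they have the same mathematical expectation and finite second moments. Assumption 3. $Q\ge0$, $R>0$, the pair $(\sqrt{\gamma}A,\sqrt{Q})$ is detectable, and the pair $(\sqrt{\gamma}(A+G),\sqrt{Q}(I-\Gamma))$ is detectable. (Here $(M,C)$ is detectable if there is a matrix $L$ such that $M+LC$ is Schur.) Assumption 4. There exist symmetric $\tilde P,\tilde\Pi\in\mathbb{R}^{n\times n}$ with $\mathcal{H}(\tilde P)>0$ and $\bar{\mathcal{H}}(\tilde\Pi)>0$, where $$\mathcal{H}(P)=\begin{bmatrix}\gamma A^{T}PA-P+Q&\gamma A^{T}PB\\ \gamma B^{T}PA&R+\gamma B^{T}PB\end{bmatrix},$$ $$\bar{\mathcal{H}}(\Pi)=\begin{bmatrix}\gamma(A+G)^{T}\Pi(A+G)-\Pi+Q+Q_\Gamma&\gamma(A+G)^{T}\Pi B\\ \gamma B^{T}\Pi(A+G)&R+\gamma B^{T}\Pi B\end{bmatrix},$$ and $Q_\Gamma=\Gamma^{T}Q\Gamma-Q\Gamma-\Gamma^{T}Q$.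 (Under Assumption 4, $Q$ and $R$ may be indefinite.) Conventions. A square matrix is Schur if all its eigenvalues have modulus $<1$. $\ge$ and $>$ between symmetric matrices denote the Loewner order. $\sqrt{Q}$ is the positive semidefinite square root. A stabilizing solution of the Riccati equation is a symmetric solution $P$ with $R+\gamma B^TPB$ invertible for which $\sqrt{\gamma}(A-BK)$ is Schur, $K=\gamma(R+\gamma B^TPB)^{-1}B^TPA$. That $K_{k+1}$ solves its equation includes that the inverse in it exists. *)

(* Defs.v *)
(* The field of real numbers is F : realType; R is kept for the input weight. *)
From HB Require Import structures.
From mathcomp Require Import all_boot all_order all_algebra.
From mathcomp Require Import finmap complex.
From mathcomp Require Import all_classical all_reals all_analysis.

Set Implicit Arguments.
Unset Strict Implicit.
Unset Printing Implicit Defensive.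

Import Order.TTheory GRing.Theory Num.Theory.
Import numFieldNormedType.Exports.

Local Open Scope classical_set_scope.
Local Open Scope ring_scope.

Definition psdmx (F : realType) (n : nat) (M : 'M[F]_n) : Prop :=
  M^T = M /\ forall v : 'cV[F]_n, 0 <= (v^T *m M *m v) 0 0.

Definition pdmx (F : realType) (n : nat) (M : 'M[F]_n) : Prop :=
  M^T = M /\ forall v : 'cV[F]_n, v != 0 -> 0 < (v^T *m M *m v) 0 0.

Definition loewner_le (F : realType) (n : nat) (X Y : 'M[F]_n) : Prop :=
  psdmx (Y - X).

(* The eigenvalues of a real matrix are taken in F[i]; comparing the norm with 1
   there is the comparison of real numbers, since norms are real. *)
Definition schur (F : realType) (n : nat) (M : 'M[F]_n) : Prop :=
  forall l : F[i], eigenvalue (map_mx (real_complex F) M) l -> `|l| < 1.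

Definition detectable (F : realType) (n p : nat)
    (M : 'M[F]_n) (C : 'M[F]_(p, n)) : Prop :=
  exists L : 'M[F]_(n, p), schur (M + L *m C).

Definition is_psd_sqrt (F : realType) (n : nat) (Q S : 'M[F]_n) : Prop :=
  psdmx S /\ S *m S = Q.

Definition gamma_stabilizer (F : realType) (n m : nat) (gamma : F)
    (A : 'M[F]_n) (B : 'M[F]_(n, m)) (K : 'M[F]_(m, n)) : Prop :=
  schur (Num.sqrt gamma *: (A - B *m K)).

Definition input_weight (F : realType) (n m : nat) (gamma : F)
    (B : 'M[F]_(n, m)) (R : 'M[F]_m) (P : 'M[F]_n) : 'M[F]_m :=
  R + gamma *: (B^T *m P *m B).

(* invmx returns its argument on singular matrices, so every use of riccati_gain
   comes with the hypothesis  input_weight gamma B R P \in unitmx. *)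
Definition riccati_gain (F : realType) (n m : nat) (gamma : F)
    (A : 'M[F]_n) (B : 'M[F]_(n, m)) (R : 'M[F]_m) (P : 'M[F]_n) : 'M[F]_(m, n) :=
  gamma *: (invmx (input_weight gamma B R P) *m B^T *m P *m A).

Definition stabilizing_solution (F : realType) (n m : nat) (gamma : F)
    (A : 'M[F]_n) (B : 'M[F]_(n, m)) (Q : 'M[F]_n) (R : 'M[F]_m)
    (P : 'M[F]_n) : Prop :=
  [/\ P^T = P,
      input_weight gamma B R P \in unitmx,
      P = gamma *: (A^T *m P *m A)
          - gamma ^+ 2 *: (A^T *m P *m B *m invmx (input_weight gamma B R P)
                             *m B^T *m P *m A)
          + Q
    & gamma_stabilizer gamma A B (riccati_gain gamma A B R P)].

(* The positive semidefinite square root of Q is unique, so quantifying it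
   existentially refers to that matrix. *)
Definition detectability_assumption (F : realType) (n m : nat) (gamma : F)
    (A G Q Gamma : 'M[F]_n) (R : 'M[F]_m) : Prop :=
  [/\ psdmx Q, pdmx R &
      exists sqrtQ : 'M[F]_n,
        [/\ is_psd_sqrt Q sqrtQ,
            detectable (Num.sqrt gamma *: A) sqrtQ
          & detectable (Num.sqrt gamma *: (A + G)) (sqrtQ *m (1%:M - Gamma))]].

Definition lmi_mx (F : realType) (n m : nat) (gamma : F)
    (A : 'M[F]_n) (B : 'M[F]_(n, m)) (Q : 'M[F]_n) (R : 'M[F]_m)
    (P : 'M[F]_n) : 'M[F]_(n + m) :=
  block_mx (gamma *: (A^T *m P *m A) - P + Q) (gamma *: (A^T *m P *m B))
           (gamma *: (B^T *m P *m A))         (R + gamma *: (B^T *m P *m B)).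

Definition mean_field_weight (F : realType) (n : nat) (Q Gamma : 'M[F]_n) : 'M[F]_n :=
  Gamma^T *m Q *m Gamma - Q *m Gamma - Gamma^T *m Q.

Definition lmi_assumption (F : realType) (n m : nat) (gamma : F)
    (A G Q Gamma : 'M[F]_n) (B : 'M[F]_(n, m)) (R : 'M[F]_m) : Prop :=
  exists Pt Pit : 'M[F]_n,
    [/\ Pt^T = Pt, Pit^T = Pit,
        pdmx (lmi_mx gamma A B Q R Pt)
      & pdmx (lmi_mx gamma (A + G) B (Q + mean_field_weight Q Gamma) R Pit)].

Definition random_vector (F : realType) (d : measure_display)
    (Omega : measurableType d) (n : nat) (X : Omega -> 'cV[F]_n) : Prop :=
  forall a : 'I_n, measurable_fun setT (fun omega => X omega a 0).

(* The Borel sigma-algebra of F^n is generated by the coordinates. *)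
Definition sigma_vector (F : realType) (d : measure_display)
    (Omega : measurableType d) (n : nat) (X : Omega -> 'cV[F]_n) : set (set Omega) :=
  g_sigma_preimage (fun (a : 'I_n) (omega : Omega) => X omega a 0).

Definition sigma_family (F : realType) (d : measure_display)
    (Omega : measurableType d) (I : Type) (n : nat)
    (X : I -> Omega -> 'cV[F]_n) : set (set Omega) :=
  <<s \bigcup_(i in [set: I]) sigma_vector (X i) >>.

Definition mutually_independent (F : realType) (d : measure_display)
    (Omega : measurableType d) (Pr : probability Omega F)
    (I : choiceType) (n : nat) (X : I -> Omega -> 'cV[F]_n) : Prop :=
  forall (J : {fset I}) (E : I -> set Omega),
    (forall i, i \in J -> sigma_vector (X i) (E i)) ->
    Pr (\bigcap_(i in [set` J]) E i) = (\prod_(i <- J) Pr (E i))%E.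

Definition independent_families (F : realType) (d : measure_display)
    (Omega : measurableType d) (Pr : probability Omega F)
    (I J : Type) (n p : nat)
    (X : I -> Omega -> 'cV[F]_n) (Y : J -> Omega -> 'cV[F]_p) : Prop :=
  forall E E' : set Omega, sigma_family X E -> sigma_family Y E' ->
    Pr (E `&` E') = (Pr E * Pr E')%E.

(* Joint independence over agents and times; zero mean and covariance sigma^2 I,
   which for q = 1 says that the scalar noise has variance sigma^2. *)
Definition white_noises (F : realType) (d : measure_display)
    (Omega : measurableType d) (Pr : probability Omega F) (N q : nat) (sigma : F)
    (w : 'I_N -> nat -> Omega -> 'cV[F]_q) : Prop :=
  [/\ forall i k, random_vector (w i k),
      mutually_independent Pr (fun ik : 'I_N * nat => w ik.1 ik.2),
      forall i k a, expectation Pr (fun omega => w i k omega a 0) = 0%E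
    & forall i k a b,
        covariance Pr (fun omega => w i k omega a 0) (fun omega => w i k omega b 0)
        = (sigma ^+ 2 *+ (a == b))%:E].

Definition agent_dynamics (F : realType) (Omega : Type) (N n m q : nat)
    (A G : 'M[F]_n) (B : 'M[F]_(n, m)) (D : 'M[F]_(n, q))
    (x : 'I_N -> nat -> Omega -> 'cV[F]_n)
    (u : 'I_N -> nat -> Omega -> 'cV[F]_m)
    (w : 'I_N -> nat -> Omega -> 'cV[F]_q) : Prop :=
  forall i k omega,
    x i k.+1 omega =
      A *m x i k omega + G *m (N%:R^-1 *: \sum_(j < N) x j k omega)
      + B *m u i k omega + D *m w i k omega.

Definition initial_state_assumption (F : realType) (d : measure_display)
    (Omega : measurableType d) (Pr : probability Omega F) (N n q : nat)
    (x0 : 'I_N -> Omega -> 'cV[F]_n)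
    (w : 'I_N -> nat -> Omega -> 'cV[F]_q) : Prop :=
  [/\ forall i, random_vector (x0 i),
      mutually_independent Pr x0,
      independent_families Pr x0 (fun ik : 'I_N * nat => w ik.1 ik.2),
      forall i j a, expectation Pr (fun omega => x0 i omega a 0)
                    = expectation Pr (fun omega => x0 j omega a 0)
    & forall i a, (expectation Pr (fun omega => x0 i omega a 0 ^+ 2)%R < +oo)%E].

(* Main.v *)
(* Absorb gamma into a = sqrt(gamma) A and b = sqrt(gamma) B. Completing the
   square in the Bellman equation expresses P_k - P as the cost of closed-loop
   trajectories whose stage cost is a square in the weight W = R + b^T P b; either
   assumption makes W positive definite. Since a - b K_k is Schur this gives
   P_k >= P, then P_k >= P_(k+1), and the same identity evaluated on an eigenvector
   carries the Schur property from K_k to K_(k+1). Finally, P_(k+1) is dominated by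
   one step of value iteration with the fixed gain K, so that
   0 <= P_k - P <= ((a - b K)^T)^k (P_0 - P) (a - b K)^k, which tends to 0. *)
Require Import Defs.
From HB Require Import structures.
From mathcomp Require Import all_boot all_order all_algebra.
From mathcomp Require Import finmap complex.
From mathcomp Require Import all_classical all_reals all_analysis.
From mathcomp Require Import ring lra.

Set Implicit Arguments.
Unset Strict Implicit.
Unset Printing Implicit Defensive.

Import Order.TTheory GRing.Theory Num.Theory.
Import numFieldNormedType.Exports.

Local Open Scope classical_set_scope.
Local Open Scope ring_scope.

(** * Geometric decay of the powers of a Schur matrix *)

(** The field is general because decay is first obtained over [F[i]], where characteristic
    polynomials split, and then transferred to [F]. *)
Definition decays_geometrically (K : numFieldType) (n p : nat)
    (Y : nat -> 'M[K]_(n, p)) : Prop :=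
  exists C rho : K, [/\ 0 <= C, 0 < rho, rho < 1
    & forall k i j, `|Y k i j| <= C * rho ^+ k].

(** Forcing of rate [rho] is absorbed at a slower rate, strictly above [|l|], so that the resonant
    case brings no polynomial factor. *)
Lemma geometric_recurrence (K : numFieldType) (n p : nat) (l : K)
    (Y : nat -> 'M[K]_(n, p)) :
  `|l| < 1 -> decays_geometrically (fun k => Y k.+1 - l *: Y k) ->
  decays_geometrically Y.
Proof.
move=> l1 [C [rho [C0 rho0 rho1 hY]]].
have l0 : 0 <= `|l| := normr_ge0 l.
(* tau lies strictly above both rho and |l|, and below 1. *)
pose tau := rho + `|l| * (1 - rho).
have tau_rho : rho <= tau by rewrite lerDl mulr_ge0 // subr_ge0 ltW.
have tau_l : tau - `|l| = rho * (1 - `|l|) by rewrite /tau; ring.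
have gap0 : 0 < rho * (1 - `|l|) by rewrite mulr_gt0 // subr_gt0.
have tau1 : tau < 1.
  rewrite -subr_gt0 (_ : 1 - tau = (1 - rho) * (1 - `|l|)); last by rewrite /tau; ring.
  by rewrite mulr_gt0 // subr_gt0.
pose S := \sum_i \sum_j `|Y 0%N i j|.
have S0 : 0 <= S by apply: sumr_ge0 => i _; apply: sumr_ge0.
have tau0 : 0 < tau by apply: lt_le_trans tau_rho.
have Cg0 : 0 <= C / (rho * (1 - `|l|)) by rewrite divr_ge0 // ltW.
(* [S] covers the initial entries; the second term is [C / (tau - |l|)], the amplitude at which one
   step of the recurrence absorbs the forcing. *)
exists (S + C / (rho * (1 - `|l|))), tau; split => //; first exact: addr_ge0.
elim=> [|k IHk] i j.
  rewrite expr0 mulr1 ler_wpDr // /S (bigD1 i) //= (bigD1 j) //= -addrA lerDl.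
  by rewrite addr_ge0 ?sumr_ge0 // => a _; apply: sumr_ge0.
have -> : Y k.+1 i j = (Y k.+1 - l *: Y k) i j + l * Y k i j.
  by rewrite !mxE; ring.
apply: le_trans (ler_normD _ _) _; rewrite normrM.
apply: le_trans (lerD (hY k i j) (ler_wpM2l l0 (IHk i j))) _.
have h1 : C * rho ^+ k <= C * tau ^+ k.
  by rewrite ler_wpM2l // lerXn2r // nnegrE ltW.
apply: le_trans (lerD h1 (lexx _)) _.
rewrite exprS -subr_ge0.
set c := C / _; have -> : C = c * (tau - `|l|).
  by rewrite tau_l /c divfK // gt_eqF.
rewrite [X in 0 <= X](_ : _ = S * (tau - `|l|) * tau ^+ k); last by ring.
by rewrite tau_l mulr_ge0 ?exprn_ge0 ?(mulr_ge0 S0) ?ltW.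
Qed.

(** The factors are peeled off one at a time, in place of a Jordan form: [(M - l) Y] is again an
    orbit of [M], to which the remaining factors apply, and [geometric_recurrence] leads from it
    back to [Y]. *)
Lemma decays_of_annihilator (K : numFieldType) (n p : nat) (M : 'M[K]_n.+1)
    (s : seq K) (Y : nat -> 'M[K]_(n.+1, p)) :
  (forall l, l \in s -> `|l| < 1) -> (forall k, Y k.+1 = M *m Y k) ->
  decays_geometrically
    (fun k => horner_mx M (\prod_(l <- s) ('X - l%:P)) *m Y k) ->
  decays_geometrically Y.
Proof.
elim: s Y => [|l s IHs] Y hs hY.
  by rewrite big_nil rmorph1; under [X in decays_geometrically X]eq_fun do rewrite mul1mx.
move=> hd; apply: (geometric_recurrence (l := l)); first by rewrite hs ?mem_head.
apply: IHs => [z zs|k|]; first by rewrite hs // inE zs orbT.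
  by rewrite mulmxBr -scalemxAr -!hY.
move: hd; congr decays_geometrically; apply/funext => k.
rewrite big_cons mulrC rmorphM /= -mulmxA; congr (_ *m _).
by rewrite rmorphB /= horner_mx_X horner_mx_C mulmxBl mul_scalar_mx hY.
Qed.

(** The characteristic polynomial splits over [F[i]] with the eigenvalues as roots, and by
    Cayley-Hamilton it annihilates the powers. *)
Lemma schur_decays (F : realType) (n : nat) (M : 'M[F]_n) :
  schur M -> decays_geometrically (fun k => M ^+ k).
Proof.
case: n M => [|n] M hM.
  exists 1, 2^-1; split=> [|||k []] //; lra.
pose Mc := map_mx (real_complex F) M.
have [s hs] := closed_field_poly_normal (char_poly Mc).
move: hs; rewrite (monicP (char_poly_monic Mc)) scale1r => hs.
have : decays_geometrically (fun k => Mc ^+ k).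
  apply: (@decays_of_annihilator _ _ _ Mc s) => [l ls|k|].
  - by apply: hM; rewrite eigenvalue_root_char hs root_prod_XsubC.
  - by rewrite exprS.
  - rewrite -hs Cayley_Hamilton; exists 0, 2^-1; split => //.
    + by rewrite invf_lt1 ?ltr1n ?ltr0n.
    + by move=> k i j; rewrite mul0mx mxE normr0 mul0r.
case=> C [rho [C0 rho0 rho1 hd]].
(* [C] and [rho] lie in [F[i]] but are nonnegative there, hence real. *)
exists (complex.Re C), (complex.Re rho).
have CE : C = (complex.Re C)%:C%C by rewrite RRe_real // ger0_real.
have rE : rho = (complex.Re rho)%:C%C by rewrite RRe_real // gtr0_real.
rewrite -lecR -ltcR -(ltcR _ 1) -CE -rE; split => // k i j.
rewrite -lecR rmorphM rmorphXn /= -CE -rE.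
have := hd k i j.
by rewrite /Mc -rmorphXn /= mxE normc_def /= expr0n addr0 sqrtr_sqr.
Qed.

(** * The Schur property in real coordinates *)

(** [eigenvalue] refers to row vectors, whereas the closed loop acts on columns. *)
Lemma eigenvalue_trmx (K : fieldType) (n : nat) (M : 'M[K]_n) (l : K) :
  eigenvalue M^T l = eigenvalue M l.
Proof.
rewrite /eigenvalue /eigenspace !kermx_eq0 !row_free_unit.
by rewrite -(unitmx_tr (M - _)) linearB /= tr_scalar_mx.
Qed.

Lemma map_complex_vector (F : realType) (n p : nat) (v : 'M[F[i]]_(n, p)) :
  v = map_mx (real_complex F) (map_mx (@complex.Re F) v)
      + 'i%C *: map_mx (real_complex F) (map_mx (@complex.Im F) v).
Proof.
by apply/matrixP => i j; rewrite !mxE -complexE.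
Qed.

(** [p] and [q] are the real and imaginary parts of an eigenvector for [al + i be], which lets real
    quadratic forms be evaluated on it. *)
Lemma schurP (F : realType) (n : nat) (M : 'M[F]_n) :
  schur M <->
  (forall (al be : F) (p q : 'cV[F]_n),
    M *m p = al *: p - be *: q -> M *m q = be *: p + al *: q ->
    (p != 0) || (q != 0) -> al ^+ 2 + be ^+ 2 < 1).
Proof.
have normE (al be : F) : (`|Complex al be| < 1) = (al ^+ 2 + be ^+ 2 < 1).
  rewrite normc_def /= -[1 in LHS]/(1%:C)%C ltcR -[in LHS]sqrtr1 ltr_sqrt //.
split=> [hM al be p q hp hq pq0|hM l].
  rewrite -normE; apply: hM; rewrite -eigenvalue_trmx; apply/eigenvalueP.
  pose v := map_mx (real_complex F) p + 'i%C *: map_mx (real_complex F) q.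
  exists v^T.
    rewrite -trmx_mul -linearZ /=; congr (_^T).
    rewrite /v mulmxDr -scalemxAr -!map_mxM hp hq.
    apply/matrixP => i j; rewrite !mxE.
    apply/eqP; rewrite eq_complex /=; apply/andP; split; apply/eqP; ring.
  rewrite trmx_eq0; apply: contraTneq pq0 => v0.
  have h i j : p i j = 0 /\ q i j = 0.
    have /eqP := congr1 (fun u : 'cV[F[i]]_n => u i j) v0.
    rewrite !mxE eq_complex /= => /andP[/eqP h1 /eqP h2].
    by split; [rewrite -h1|rewrite -h2]; ring.
  by rewrite negb_or !negbK; apply/andP; split; apply/eqP/matrixP => i j;
    rewrite mxE; case: (h i j).
rewrite -eigenvalue_trmx => /eigenvalueP[w hw w0].
case: l hw => al be hw; rewrite normE.
have hv : map_mx (real_complex F) M *m w^T = Complex al be *: w^T.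
  by rewrite -[_ *m _]trmxK trmx_mul trmxK hw linearZ.
pose p := map_mx (@complex.Re F) w^T; pose q := map_mx (@complex.Im F) w^T.
have hpq : map_mx (real_complex F) (M *m p) + 'i%C *: map_mx (real_complex F) (M *m q)
    = map_mx (real_complex F) (al *: p - be *: q)
      + 'i%C *: map_mx (real_complex F) (be *: p + al *: q).
  rewrite !map_mxM scalemxAr -mulmxDr -map_complex_vector hv.
  rewrite [w^T in LHS]map_complex_vector -/p -/q.
  apply/matrixP => i j; rewrite !mxE.
  apply/eqP; rewrite eq_complex /=; apply/andP; split; apply/eqP; ring.
apply: (hM al be p q).
- apply/matrixP => i j; have := congr1 (fun u : 'cV[F[i]]_n => complex.Re (u i j)) hpq.
  by rewrite !mxE /= !(mul0r, mulr0, mul1r, subr0, addr0, add0r, subrr).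
- apply/matrixP => i j; have := congr1 (fun u : 'cV[F[i]]_n => complex.Im (u i j)) hpq.
  by rewrite !mxE /= !(mul0r, mulr0, mul1r, subr0, addr0, add0r).
- apply: contraNT w0; rewrite negb_or !negbK => /andP[/eqP p0 /eqP q0].
  by rewrite -trmx_eq0 (map_complex_vector w^T) -/p -/q p0 q0 !map_mx0 scaler0 addr0.
Qed.

(** * Entrywise limits of matrices *)

Lemma cvg_mx_sub0 (F : realType) (n p : nat) (Y : nat -> 'M[F]_(n, p)) (Z : 'M[F]_(n, p)) :
  (forall i j, (Y k - Z) i j @[k --> \oo] --> (0 : F)) -> Y k @[k --> \oo] --> Z.
Proof.
move=> hYZ.
have hY i j : Y k i j @[k --> \oo] --> Z i j.
  apply: (@cvg_sub0 _ _ _ _ _ _ (fun=> Z i j)); last exact: cvg_cst.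
  by move: (hYZ i j); under eq_cvg do rewrite !mxE.
move=> S [T hT hTS]; near=> k; apply: hTS => i j; move: i j; near: k.
apply: filter_forall => i; apply: filter_forall => j; exact: (hY i j _ (hT i j)).
Unshelve. all: by end_near. Qed.

Lemma cvg_mulmx_entries (F : realType) (n p q : nat)
    (Y : nat -> 'M[F]_(n, p)) (Y0 : 'M[F]_(n, p))
    (Z : nat -> 'M[F]_(p, q)) (Z0 : 'M[F]_(p, q)) :
  (forall i j, Y k i j @[k --> \oo] --> Y0 i j) ->
  (forall i j, Z k i j @[k --> \oo] --> Z0 i j) ->
  forall i j, (Y k *m Z k) i j @[k --> \oo] --> (Y0 *m Z0) i j.
Proof.
move=> hY hZ i j; rewrite mxE; under eq_cvg do rewrite mxE.
apply: cvg_big => [|l _]; first exact: add_continuous.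
exact: cvgM.
Qed.

(** * Quadratic forms and the Lyapunov argument *)

(** The expression in [psdmx] and [pdmx], with two arguments so that it expands by bilinearity. *)
Definition bform (F : realType) (n : nat) (X : 'M[F]_n) (u v : 'cV[F]_n) : F :=
  (u^T *m X *m v) 0 0.

Lemma bformC (F : realType) (n : nat) (X : 'M[F]_n) (u v : 'cV[F]_n) :
  X^T = X -> bform X u v = bform X v u.
Proof.
move=> hX; rewrite /bform.
have -> : v^T *m X *m u = (u^T *m X *m v)^T by rewrite !trmx_mul trmxK hX mulmxA.
by rewrite [RHS]mxE.
Qed.

Lemma bformDl (F : realType) (n : nat) (X : 'M[F]_n) (u u' v : 'cV[F]_n) :
  bform X (u + u') v = bform X u v + bform X u' v.
Proof. by rewrite /bform linearD /= !mulmxDl mxE. Qed.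

Lemma bformDr (F : realType) (n : nat) (X : 'M[F]_n) (u v v' : 'cV[F]_n) :
  bform X u (v + v') = bform X u v + bform X u v'.
Proof. by rewrite /bform mulmxDr mxE. Qed.

Lemma bformZl (F : realType) (n : nat) (X : 'M[F]_n) (c : F) (u v : 'cV[F]_n) :
  bform X (c *: u) v = c * bform X u v.
Proof. by rewrite /bform linearZ /= -!scalemxAl mxE. Qed.

Lemma bformZr (F : realType) (n : nat) (X : 'M[F]_n) (c : F) (u v : 'cV[F]_n) :
  bform X u (c *: v) = c * bform X u v.
Proof. by rewrite /bform -!scalemxAr mxE. Qed.

Lemma bformNl (F : realType) (n : nat) (X : 'M[F]_n) (u v : 'cV[F]_n) :
  bform X (- u) v = - bform X u v.
Proof. by rewrite -scaleN1r bformZl mulN1r. Qed.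

Lemma bformNr (F : realType) (n : nat) (X : 'M[F]_n) (u v : 'cV[F]_n) :
  bform X u (- v) = - bform X u v.
Proof. by rewrite -scaleN1r bformZr mulN1r. Qed.

Lemma bform0r (F : realType) (n : nat) (X : 'M[F]_n) (u : 'cV[F]_n) :
  bform X u 0 = 0.
Proof. by rewrite -[0 in LHS](scale0r 0) bformZr mul0r. Qed.

Lemma bformDm (F : realType) (n : nat) (X Y : 'M[F]_n) (u v : 'cV[F]_n) :
  bform (X + Y) u v = bform X u v + bform Y u v.
Proof. by rewrite /bform mulmxDr mulmxDl mxE. Qed.

Lemma bformNm (F : realType) (n : nat) (X : 'M[F]_n) (u v : 'cV[F]_n) :
  bform (- X) u v = - bform X u v.
Proof. by rewrite /bform mulmxN mulNmx mxE. Qed.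

Lemma bform_congr (F : realType) (n m : nat) (X : 'M[F]_n) (N : 'M[F]_(n, m))
    (u v : 'cV[F]_m) :
  bform (N^T *m X *m N) u v = bform X (N *m u) (N *m v).
Proof. by rewrite /bform trmx_mul !mulmxA. Qed.

Lemma bform_delta (F : realType) (n : nat) (X : 'M[F]_n) (i j : 'I_n) :
  bform X (delta_mx i 0) (delta_mx j 0) = X i j.
Proof. by rewrite /bform trmx_delta -rowE -colE !mxE. Qed.

Lemma cvg_bform_schur (F : realType) (n : nat) (M X : 'M[F]_n) (v : 'cV[F]_n) :
  schur M -> bform X (M ^+ k *m v) (M ^+ k *m v) @[k --> \oo] --> (0 : F).
Proof.
move=> /schur_decays[C [rho [C0 rho0 rho1 hd]]].
have hM i j : (M ^+ k) i j @[k --> \oo] --> (0 : 'M[F]_n) i j.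
  rewrite mxE; apply: norm_cvg0.
  apply: (squeeze_cvgr (f := fun=> 0) (h := geometric C rho)).
  - by apply: nearW => k; rewrite normr_ge0 /=; apply: hd.
  - exact: cvg_cst.
  - by apply: cvg_geometric; rewrite gtr0_norm.
have hMv i j : (M ^+ k *m v) i j @[k --> \oo] --> (0 : 'cV[F]_n) i j.
  rewrite -(mul0mx _ v).
  apply: (cvg_mulmx_entries hM (Z := fun=> v)) => a b; exact: cvg_cst.
rewrite -(bform0r X 0) /bform; apply: (cvg_mulmx_entries _ hMv).
apply: (cvg_mulmx_entries _ (Z := fun=> X)) => i j; last exact: cvg_cst.
rewrite mxE; under eq_cvg do rewrite mxE; exact: hMv.
Qed.

(** Along the orbit [M ^+ k *m v] the form does not increase and tends to 0, so it starts
    nonnegative. The Loewner comparisons below rest on this. *)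
Lemma bform_schur_ge0 (F : realType) (n : nat) (M X : 'M[F]_n) :
  schur M -> (forall v, bform X (M *m v) (M *m v) <= bform X v v) ->
  forall v, 0 <= bform X v v.
Proof.
move=> hM hX v; have hlim := @cvg_bform_schur _ _ M X v hM.
apply: (cvgr_to_le hlim); apply: nearW => k.
elim: k => [|k IHk]; first by rewrite expr0 mul1mx.
by apply: le_trans IHk; rewrite exprS -mulmxA.
Qed.

Lemma pdmx_bform_ge0 (F : realType) (n : nat) (W : 'M[F]_n) :
  pdmx W -> forall v, 0 <= bform W v v.
Proof.
move=> [_ hW] v; have [->|v0] := eqVneq v 0; first by rewrite bform0r.
exact: ltW (hW v v0).
Qed.

Lemma pdmx_bform_le0_eq0 (F : realType) (n : nat) (W : 'M[F]_n) (v : 'cV[F]_n) :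
  pdmx W -> bform W v v <= 0 -> v = 0.
Proof.
move=> [_ hW] hv; apply/eqP; apply: contraTT hv => v0.
by rewrite -ltNge; apply: hW.
Qed.

Lemma pdmx_unit (F : realType) (n : nat) (W : 'M[F]_n) : pdmx W -> W \in unitmx.
Proof.
move=> hW; rewrite -unitmx_tr unitmxE unitfE; apply/det0P => -[w w0 hw].
suff /eqP : w^T = 0 by rewrite trmx_eq0 (negbTE w0).
apply: (pdmx_bform_le0_eq0 hW).
by rewrite /bform -mulmxA -[W *m _]trmxK trmx_mul trmxK hw trmx0 mulmx0 mxE.
Qed.

Lemma bform_cauchy_schwarz (F : realType) (n : nat) (W : 'M[F]_n) (u v : 'cV[F]_n) :
  pdmx W -> bform W u v ^+ 2 <= bform W u u * bform W v v.
Proof.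
move=> hW; have [->|u0] := eqVneq u 0.
  by rewrite (bformC _ _ hW.1) !bform0r expr0n /= mul0r.
have hu : 0 < bform W u u := hW.2 u u0.
(* Up to the factor [bform W u u], this vector is [v] minus its [W]-orthogonal projection onto
   [u]. *)
have := pdmx_bform_ge0 hW (bform W u u *: v - bform W u v *: u).
rewrite !(bformDl, bformDr, bformNl, bformNr, bformZl, bformZr) (bformC v u hW.1).
rewrite [X in 0 <= X -> _](_ : _ =
  bform W u u * (bform W u u * bform W v v - bform W u v ^+ 2)); last by ring.
by rewrite pmulr_rge0 // subr_ge0.
Qed.

(** * Bellman identities *)

(** The Lyapunov equation of the gain [K], read on vectors. *)
Definition closed_loop_cost (F : realType) (n m : nat) (a : 'M[F]_n) (b : 'M[F]_(n, m))
    (Q : 'M[F]_n) (R : 'M[F]_m) (K : 'M[F]_(m, n)) (P : 'M[F]_n) : Prop :=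
  forall v, bform P v v = bform P ((a - b *m K) *m v) ((a - b *m K) *m v)
                          + bform R (K *m v) (K *m v) + bform Q v v.

(** Stationarity in the input of one stage cost plus the continuation cost [P], kept as a linear
    equation to avoid inverses. *)
Definition greedy_gain (F : realType) (n m : nat) (a : 'M[F]_n) (b : 'M[F]_(n, m))
    (R : 'M[F]_m) (P : 'M[F]_n) (K : 'M[F]_(m, n)) : Prop :=
  (R + b^T *m P *m b) *m K = b^T *m P *m a.

(** As a function of the input, the left side is quadratic with weight [R + b^T P b] and stationary
    at [K' v], so only the square of the deviation remains. *)
Lemma complete_square (F : realType) (n m : nat) (a : 'M[F]_n) (b : 'M[F]_(n, m))
    (R : 'M[F]_m) (P : 'M[F]_n) (K' : 'M[F]_(m, n)) :
  R^T = R -> P^T = P -> greedy_gain a b R P K' -> forall K v,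
  bform P ((a - b *m K) *m v) ((a - b *m K) *m v) + bform R (K *m v) (K *m v) =
  bform P ((a - b *m K') *m v) ((a - b *m K') *m v) + bform R (K' *m v) (K' *m v)
  + bform (R + b^T *m P *m b) (K *m v - K' *m v) (K *m v - K' *m v).
Proof.
move=> hR hP hK' K v; set W := R + _.
have hW : W^T = W by rewrite /W linearD /= !trmx_mul trmxK hR hP mulmxA.
have cross y : bform P (b *m y) (a *m v) = bform W y (K' *m v).
  by rewrite /bform trmx_mul -!mulmxA (mulmxA W) hK' !mulmxA.
have WE y z : bform W y z = bform R y z + bform P (b *m y) (b *m z).
  by rewrite /W bformDm bform_congr.
have expand y : bform P (a *m v - b *m y) (a *m v - b *m y) + bform R y y
    = bform P (a *m v) (a *m v) - 2 * bform W y (K' *m v) + bform W y y.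
  rewrite (WE y y) -cross !(bformDl, bformDr, bformNl, bformNr).
  by rewrite (bformC (a *m v) (b *m y) hP); ring.
rewrite !mulmxBl -!mulmxA !expand.
rewrite !(bformDl, bformDr, bformNl, bformNr) (bformC (K' *m v) (K *m v) hW).
by ring.
Qed.

(** Completes the square around [K], which is greedy for its own cost. The result is a Lyapunov
    equation for the gap, with a nonnegative source once the weight is positive definite. *)
Lemma policy_gap (F : realType) (n m : nat) (a : 'M[F]_n) (b : 'M[F]_(n, m))
    (Q : 'M[F]_n) (R : 'M[F]_m) (P P' : 'M[F]_n) (K K' : 'M[F]_(m, n)) :
  R^T = R -> P^T = P ->
  closed_loop_cost a b Q R K P -> greedy_gain a b R P K ->
  closed_loop_cost a b Q R K' P' -> forall v,
  bform (P' - P) v v = bform (P' - P) ((a - b *m K') *m v) ((a - b *m K') *m v)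
    + bform (R + b^T *m P *m b) (K' *m v - K *m v) (K' *m v - K *m v).
Proof.
move=> hR hP cP gP cP' v; have := complete_square hR hP gP K' v.
by rewrite !bformDm !bformNm (cP v) (cP' v) => h; lra.
Qed.

(** Two completions of the square: around [K] in the weight of [P], and around [K''] in the weight
    of [P']. The gap is thus followed along the improved policy, whose stability is not yet
    known. *)
Lemma improved_policy_gap (F : realType) (n m : nat) (a : 'M[F]_n) (b : 'M[F]_(n, m))
    (Q : 'M[F]_n) (R : 'M[F]_m) (P P' : 'M[F]_n) (K K' K'' : 'M[F]_(m, n)) :
  R^T = R -> P^T = P -> P'^T = P' ->
  closed_loop_cost a b Q R K P -> greedy_gain a b R P K ->
  closed_loop_cost a b Q R K' P' -> greedy_gain a b R P' K'' -> forall v,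
  bform (P' - P) v v = bform (P' - P) ((a - b *m K'') *m v) ((a - b *m K'') *m v)
    + bform (R + b^T *m P *m b) (K'' *m v - K *m v) (K'' *m v - K *m v)
    + bform (R + b^T *m P' *m b) (K' *m v - K'' *m v) (K' *m v - K'' *m v).
Proof.
move=> hR hP hP' cP gP cP' gP' v.
have := complete_square hR hP gP K'' v; have := complete_square hR hP' gP' K' v.
by rewrite !bformDm !bformNm (cP v) (cP' v) => h1 h2; lra.
Qed.

(** * Stability and convergence of policy iteration *)

Lemma weight_monotone (F : realType) (n m : nat) (b : 'M[F]_(n, m)) (R : 'M[F]_m)
    (X Y : 'M[F]_n) :
  R^T = R -> Y^T = Y -> pdmx (R + b^T *m X *m b) ->
  (forall v, 0 <= bform (Y - X) v v) -> pdmx (R + b^T *m Y *m b).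
Proof.
move=> hR hY [_ hX] hXY; split; first by rewrite linearD /= !trmx_mul trmxK hR hY mulmxA.
move=> y y0; rewrite -[X in 0 < X]/(bform _ y y).
apply: lt_le_trans (hX y y0) _; rewrite -[X in X <= _]/(bform _ y y).
rewrite !bformDm !bform_congr lerD2l -subr_ge0 -bformNm -bformDm; exact: hXY.
Qed.

(* For an eigenvector of a - b K'' with |eigenvalue| >= 1 every term of the gap
   identity vanishes, hence K'' and K agree on it, and it is also an eigenvector
   of the Schur matrix a - b K. *)
Lemma improved_policy_schur (F : realType) (n m : nat) (a : 'M[F]_n) (b : 'M[F]_(n, m))
    (Q : 'M[F]_n) (R : 'M[F]_m) (P P' : 'M[F]_n) (K K' K'' : 'M[F]_(m, n)) :
  R^T = R -> P^T = P -> P'^T = P' ->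
  closed_loop_cost a b Q R K P -> greedy_gain a b R P K ->
  closed_loop_cost a b Q R K' P' -> greedy_gain a b R P' K'' ->
  pdmx (R + b^T *m P *m b) -> schur (a - b *m K) -> schur (a - b *m K') ->
  schur (a - b *m K'').
Proof.
move=> hR hP hP' cP gP cP' gP' hW sK sK'.
have gap_ge0 : forall v, 0 <= bform (P' - P) v v.
  apply: (bform_schur_ge0 sK') => v.
  by rewrite [leRHS](policy_gap hR hP cP gP cP') lerDl pdmx_bform_ge0.
have hW' := weight_monotone hR hP' hW gap_ge0.
have gap := improved_policy_gap hR hP hP' cP gP cP' gP'.
apply/schurP => al be p q hp hq pq0; rewrite ltNge; apply/negP => le1.
have sym : (P' - P)^T = P' - P by rewrite linearB /= hP hP'.
(* This is the Hermitian form of [P' - P] at [p + i q], scaled by the squared modulus of the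
   eigenvalue; the cross terms cancel by symmetry. *)
have rot : bform (P' - P) ((a - b *m K'') *m p) ((a - b *m K'') *m p)
    + bform (P' - P) ((a - b *m K'') *m q) ((a - b *m K'') *m q)
    = (al ^+ 2 + be ^+ 2) * (bform (P' - P) p p + bform (P' - P) q q).
  rewrite hp hq !(bformDl, bformDr, bformNl, bformNr, bformZl, bformZr).
  by rewrite (bformC q p sym); ring.
have Wp := pdmx_bform_ge0 hW (K'' *m p - K *m p).
have Wq := pdmx_bform_ge0 hW (K'' *m q - K *m q).
have := pdmx_bform_ge0 hW' (K' *m p - K'' *m p).
have := pdmx_bform_ge0 hW' (K' *m q - K'' *m q).
have gp := gap p; have gq := gap q.
have le2 : bform (P' - P) p p + bform (P' - P) q q
    <= (al ^+ 2 + be ^+ 2) * (bform (P' - P) p p + bform (P' - P) q q).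
  by rewrite -[leLHS]mul1r ler_wpM2r // addr_ge0.
move=> W'q W'p.
have agree r : bform (R + b^T *m P *m b) (K'' *m r - K *m r) (K'' *m r - K *m r) <= 0 ->
    (a - b *m K'') *m r = (a - b *m K) *m r.
  move=> /(pdmx_bform_le0_eq0 hW)/eqP; rewrite subr_eq0 => /eqP e.
  by rewrite !mulmxBl -!mulmxA e.
(* Adding [gp] and [gq], [rot] and [le2] leave four nonnegative terms whose sum is at most 0. *)
have eq_p : (a - b *m K'') *m p = (a - b *m K) *m p by apply: agree; lra.
have eq_q : (a - b *m K'') *m q = (a - b *m K) *m q by apply: agree; lra.
move/schurP/(_ al be p q): sK; rewrite -eq_p -eq_q => /(_ hp hq pq0).
by rewrite ltNge le1.
Qed.

(** The result with the discount absorbed; the two alternative assumptions enter through positive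
    definiteness of the weight of [P]. *)
Lemma policy_iteration (F : realType) (n m : nat) (a : 'M[F]_n) (b : 'M[F]_(n, m))
    (Q : 'M[F]_n) (R : 'M[F]_m) (P : 'M[F]_n) (K : 'M[F]_(m, n))
    (P_ : nat -> 'M[F]_n) (K_ : nat -> 'M[F]_(m, n)) :
  R^T = R -> P^T = P -> (forall k, (P_ k)^T = P_ k) ->
  closed_loop_cost a b Q R K P -> greedy_gain a b R P K -> schur (a - b *m K) ->
  pdmx (R + b^T *m P *m b) ->
  (forall k, closed_loop_cost a b Q R (K_ k) (P_ k)) ->
  (forall k, greedy_gain a b R (P_ k) (K_ k.+1)) -> schur (a - b *m K_ 0%N) ->
  [/\ forall k, schur (a - b *m K_ k),
      forall k, loewner_le (P_ k.+1) (P_ k) /\ loewner_le P (P_ k.+1),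
      P_ k @[k --> \oo] --> P
    & K_ k @[k --> \oo] --> K].
Proof.
move=> hR hP hP_ cP gP sK hW cP_ gP_ s0.
have sK_ k : schur (a - b *m K_ k).
  elim: k => [|k IHk]; first exact: s0.
  exact: (improved_policy_schur hR hP (hP_ k) cP gP (cP_ k) (gP_ k) hW sK IHk).
have ge0 k : forall v, 0 <= bform (P_ k - P) v v.
  apply: (bform_schur_ge0 (sK_ k)) => v.
  by rewrite [leRHS](policy_gap hR hP cP gP (cP_ k)) lerDl pdmx_bform_ge0.
have hW_ k := weight_monotone hR (hP_ k) hW (ge0 k).
(* [K_ k.+1] is greedy against [P_ k], so [P_ k - P_ k.+1] does not increase along its closed
   loop. *)
have decr k : forall v, 0 <= bform (P_ k - P_ k.+1) v v.
  apply: (bform_schur_ge0 (sK_ k.+1)) => v.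
  have := complete_square hR (hP_ k) (gP_ k) (K_ k) v.
  have := pdmx_bform_ge0 (hW_ k) (K_ k *m v - K_ k.+1 *m v).
  by rewrite !bformDm !bformNm (cP_ k v) (cP_ k.+1 v) => h1 h2; lra.
(* One step of value iteration with the suboptimal gain K bounds P_(k+1). *)
have contract k v : bform (P_ k.+1 - P) v v
    <= bform (P_ k - P) ((a - b *m K) *m v) ((a - b *m K) *m v).
  have h1 := complete_square hR (hP_ k) (gP_ k) K v.
  have h2 := pdmx_bform_ge0 (hW_ k) (K *m v - K_ k.+1 *m v).
  have := decr k ((a - b *m K_ k.+1) *m v).
  move: h1; rewrite !bformDm !bformNm (cP_ k.+1 v) (cP v).
  move: h2; rewrite !bformDm => h2 h1 h3; lra.
have iterated k v : bform (P_ k - P) v v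
    <= bform (P_ 0%N - P) ((a - b *m K) ^+ k *m v) ((a - b *m K) ^+ k *m v).
  elim: k v => [|k IHk] v; first by rewrite expr0 mul1mx.
  by apply: le_trans (contract k v) _; rewrite exprSr -mulmxA; exact: IHk.
have gap0 v : bform (P_ k - P) v v @[k --> \oo] --> (0 : F).
  apply: (squeeze_cvgr (f := fun=> 0) _ _ (cvg_bform_schur _ v sK)); last exact: cvg_cst.
  by apply: nearW => k; rewrite ge0; apply: iterated.
split => //.
- move=> k; split; split; [|exact: decr| |exact: ge0];
    by rewrite linearB /= ?hP ?hP_.
- apply: cvg_mx_sub0 => i j.
  pose e (l : 'I_n) : 'cV[F]_n := delta_mx l 0.
  (* Polarization: [gap0] controls the form only at equal arguments. *)
  have polar k : (P_ k - P) i j = 2^-1 * (bform (P_ k - P) (e i + e j) (e i + e j)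
      - bform (P_ k - P) (e i) (e i) - bform (P_ k - P) (e j) (e j)).
    have sym : (P_ k - P)^T = P_ k - P by rewrite linearB /= hP hP_.
    rewrite !(bformDl, bformDr) (bformC (e j) (e i) sym) -bform_delta -/(e i) -/(e j).
    by field.
  under eq_cvg do rewrite polar.
  have := @cvgM _ _ _ _ _ _ _ _ (cvg_cst (2^-1 : F))
    (cvgB (cvgB (gap0 (e i + e j)) (gap0 (e i))) (gap0 (e j))).
  by rewrite !subr0 mulr0; exact.
(* The shift is there because [P_ k] determines [K_ k.+1]. *)
- rewrite -(cvg_shiftS K_); apply: cvg_mx_sub0 => i j; apply: norm_cvg0.
  (* Pairing with [z] in the weight extracts coordinate [i]. Cauchy-Schwarz then brings in the
     weighted norm of column [j] of [K_ k.+1 - K], whose square [improved_policy_gap] bounds by the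
     gap at [e]. *)
  pose z : 'cV[F]_m := invmx (R + b^T *m P *m b) *m delta_mx i 0.
  pose e : 'cV[F]_n := delta_mx j 0.
  have dual k : bform (R + b^T *m P *m b) z ((K_ k.+1 - K) *m e) = (K_ k.+1 - K) i j.
    rewrite bformC ?hW.1 // /bform /z -[(_ *m e)^T *m _ *m _]mulmxA.
    by rewrite /e (mulmxA _ (invmx _)) mulmxV ?pdmx_unit // mul1mx -!colE !mxE.
  apply: (squeeze_cvgr (f := fun=> 0)
    (h := fun k => Num.sqrt (bform (R + b^T *m P *m b) z z * bform (P_ k - P) e e))).
  + apply: nearW => k; rewrite normr_ge0 /=.
    rewrite -sqrtr_sqr ler_wsqrtr // -dual.
    apply: le_trans (bform_cauchy_schwarz _ _ hW) _; rewrite ler_wpM2l ?pdmx_bform_ge0 //.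
    have := improved_policy_gap hR hP (hP_ k) cP gP (cP_ k) (gP_ k) e.
    have := ge0 k ((a - b *m K_ k.+1) *m e).
    have := pdmx_bform_ge0 (hW_ k) (K_ k *m e - K_ k.+1 *m e).
    by rewrite (mulmxBl (K_ k.+1)) => h1 h2 h3; lra.
  + exact: cvg_cst.
  + rewrite -[X in _ --> X]sqrtr0; apply: continuous_cvg; first exact: sqrt_continuous.
    rewrite -[X in _ --> X](mulr0 (bform (R + b^T *m P *m b) z z)).
    by apply: cvgM; [exact: cvg_cst|exact: gap0].
Qed.

(** * Absorbing the discount factor *)

Lemma sqrt_scaled_congr (F : realType) (n p q : nat) (gamma : F) (X : 'M[F]_n)
    (N : 'M[F]_(n, p)) (L : 'M[F]_(n, q)) : 0 < gamma ->
  (Num.sqrt gamma *: N)^T *m X *m (Num.sqrt gamma *: L) = gamma *: (N^T *m X *m L).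
Proof.
move=> g0; rewrite [(_ *: N)^T]linearZ /= -scalemxAr -!scalemxAl scalerA -expr2 sqr_sqrtr //.
exact: ltW.
Qed.

Lemma input_weight_sqrt (F : realType) (n m : nat) (gamma : F)
    (B : 'M[F]_(n, m)) (R : 'M[F]_m) (X : 'M[F]_n) : 0 < gamma ->
  input_weight gamma B R X
  = R + (Num.sqrt gamma *: B)^T *m X *m (Num.sqrt gamma *: B).
Proof. by move=> g0; rewrite sqrt_scaled_congr. Qed.

Lemma riccati_gain_greedy (F : realType) (n m : nat) (gamma : F)
    (A : 'M[F]_n) (B : 'M[F]_(n, m)) (R : 'M[F]_m) (X : 'M[F]_n) :
  0 < gamma -> input_weight gamma B R X \in unitmx ->
  greedy_gain (Num.sqrt gamma *: A) (Num.sqrt gamma *: B) R X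
    (riccati_gain gamma A B R X).
Proof.
move=> g0 hW; rewrite /greedy_gain -input_weight_sqrt // sqrt_scaled_congr //.
by rewrite /riccati_gain -scalemxAr -!mulmxA mulKVmx.
Qed.

Lemma riccati_closed_loop_cost (F : realType) (n m : nat) (gamma : F)
    (A : 'M[F]_n) (B : 'M[F]_(n, m)) (Q : 'M[F]_n) (R : 'M[F]_m) (P : 'M[F]_n) :
  0 < gamma -> R^T = R -> stabilizing_solution gamma A B Q R P ->
  closed_loop_cost (Num.sqrt gamma *: A) (Num.sqrt gamma *: B) Q R
    (riccati_gain gamma A B R P) P.
Proof.
move=> g0 hR [hP hW hric _] v.
have gP := riccati_gain_greedy A g0 hW.
set a := _ *: A in gP *; set b := _ *: B in gP *; set K := riccati_gain _ _ _ _ _ in gP *.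
have hric' : P = a^T *m P *m a - a^T *m P *m b *m K + Q.
  rewrite {1}hric /a /b !sqrt_scaled_congr //; congr (_ - _ + _).
  by rewrite /K /riccati_gain -scalemxAr -scalemxAl scalerA -expr2 !mulmxA.
(* The zero input costs the same as the gain K plus the square of K in the weight. *)
have := complete_square hR hP gP 0 v.
rewrite mulmx0 subr0 !mul0mx sub0r !(bformNl, bformNr) opprK bform0r addr0.
have -> : bform (R + b^T *m P *m b) (K *m v) (K *m v)
    = bform (a^T *m P *m b *m K) v v.
  transitivity (bform P (b *m (K *m v)) (a *m v)).
    by move: gP; rewrite /greedy_gain; set W := R + _ => gP;
      rewrite /bform (trmx_mul b) -!mulmxA (mulmxA W) gP !mulmxA.
  by rewrite bformC // /bform trmx_mul !mulmxA.
have -> : bform P v v = bform P (a *m v) (a *m v)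
    - bform (a^T *m P *m b *m K) v v + bform Q v v.
  by rewrite [in LHS]hric' !bformDm bformNm bform_congr.
by move=> h; lra.
Qed.

(** * Positive definiteness of the weight *)

(** The stage costs are nonnegative, so [P >= 0] and the weight dominates [R]; hence the comparison
    with [X = 0]. *)
Lemma detectability_weight_pd (F : realType) (n m : nat) (a : 'M[F]_n) (b : 'M[F]_(n, m))
    (Q : 'M[F]_n) (R : 'M[F]_m) (K : 'M[F]_(m, n)) (P : 'M[F]_n) :
  P^T = P -> psdmx Q -> pdmx R -> closed_loop_cost a b Q R K P ->
  schur (a - b *m K) -> pdmx (R + b^T *m P *m b).
Proof.
move=> hP [_ hQ] hR cP sK; apply: (weight_monotone (X := 0) hR.1 hP).
  by rewrite mulmx0 mul0mx addr0.
rewrite subr0; apply: (bform_schur_ge0 sK) => v.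
by rewrite [leRHS]cP -addrA lerDl addr_ge0 ?(pdmx_bform_ge0 hR) //; apply: hQ.
Qed.

(** The block form at [(v, - K v)] shows that [P - X] does not increase along the closed loop, hence
    [P >= X]; at [(0, y)] it gives [R + b^T X b > 0], which [weight_monotone] carries over to
    [P]. *)
Lemma lmi_weight_pd (F : realType) (n m : nat) (a : 'M[F]_n) (b : 'M[F]_(n, m))
    (Q : 'M[F]_n) (R : 'M[F]_m) (K : 'M[F]_(m, n)) (P X : 'M[F]_n) :
  R^T = R -> P^T = P -> X^T = X -> closed_loop_cost a b Q R K P ->
  schur (a - b *m K) ->
  pdmx (block_mx (a^T *m X *m a - X + Q) (a^T *m X *m b)
                 (b^T *m X *m a) (R + b^T *m X *m b)) ->
  pdmx (R + b^T *m P *m b).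
Proof.
move=> hR hP hX cP sK hL.
set H := block_mx _ _ _ _ in hL.
have form v y : bform H (col_mx v y) (col_mx v y) =
    bform X (a *m v + b *m y) (a *m v + b *m y) - bform X v v + bform Q v v + bform R y y.
  rewrite {1}/bform tr_col_mx mul_row_block mul_row_col !mulmxDl.
  rewrite !(bformDl, bformDr) -!bform_congr.
  have -> : bform X (a *m v) (b *m y) = (v^T *m (a^T *m X *m b) *m y) 0 0.
    by rewrite /bform trmx_mul !mulmxA.
  have -> : bform X (b *m y) (a *m v) = (y^T *m (b^T *m X *m a) *m v) 0 0.
    by rewrite /bform trmx_mul !mulmxA.
  rewrite /bform !mulmxDr !mulmxDl mulmxN mulNmx !mxE; ring.
apply: (weight_monotone (X := X) hR hP).
  split=> [|y y0]; first by rewrite linearD /= !trmx_mul trmxK hR hX mulmxA.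
  rewrite -[ltRHS]/(bform (R + b^T *m X *m b) y y) bformDm bform_congr.
  have : 0 < bform H (col_mx 0 y) (col_mx 0 y).
    by apply: hL.2; rewrite col_mx_eq0 negb_and y0 orbT.
  by rewrite form mulmx0 add0r !bform0r subr0 addr0 addrC.
apply: (bform_schur_ge0 sK) => v.
have := pdmx_bform_ge0 hL (col_mx v (- (K *m v))).
rewrite form mulmxN mulmxA -mulmxBl !(bformNl, bformNr) opprK !bformDm !bformNm (cP v).
lra.
Qed.

Theorem theorem1 (F : realType) (N n m q : nat) (hN : (0 < N)%N)
  (A G Q Gamma : 'M[F]_n) (B : 'M[F]_(n, m)) (R : 'M[F]_m) (D : 'M[F]_(n, q))
  (gamma sigma : F)
  (hQ : Q^T = Q) (hR : R^T = R) (hgamma0 : 0 < gamma) (hgamma1 : gamma < 1)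
  (* the agents *)
  (d : measure_display) (Omega : measurableType d) (Pr : probability Omega F)
  (x : 'I_N -> nat -> Omega -> 'cV[F]_n)
  (u : 'I_N -> nat -> Omega -> 'cV[F]_m)
  (w : 'I_N -> nat -> Omega -> 'cV[F]_q)
  (hw : white_noises Pr sigma w)
  (hu : forall i k, random_vector (u i k))
  (hx : agent_dynamics A G B D x u w)
  (hx0 : initial_state_assumption Pr (fun i => x i 0%N) w)
  (* the iteration *)
  (P_ : nat -> 'M[F]_n) (K_ : nat -> 'M[F]_(m, n))
  (hK0 : gamma_stabilizer gamma A B (K_ 0%N))
  (hPsym : forall k, (P_ k)^T = P_ k)
  (hP : forall k,
     P_ k = gamma *: ((A - B *m K_ k)^T *m P_ k *m (A - B *m K_ k))
            + (K_ k)^T *m R *m K_ k + Q)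
  (hKunit : forall k, input_weight gamma B R (P_ k) \in unitmx)
  (hK : forall k, K_ k.+1 = riccati_gain gamma A B R (P_ k))
  (* the stabilizing solution of the Riccati equation *)
  (P : 'M[F]_n) (hPstab : stabilizing_solution gamma A B Q R P)
  (K : 'M[F]_(m, n)) (hKdef : K = riccati_gain gamma A B R P)
  (hassum : detectability_assumption gamma A G Q Gamma R
            \/ lmi_assumption gamma A G Q Gamma B R) :
  [/\ forall k, schur (Num.sqrt gamma *: (A - B *m K_ k)),
      forall k, loewner_le (P_ k.+1) (P_ k) /\ loewner_le P (P_ k.+1),
      P_ k @[k --> \oo] --> P
    & K_ k @[k --> \oo] --> K].
Proof.
have [hPs hW hric sK] := hPstab.
have closed L : Num.sqrt gamma *: A - Num.sqrt gamma *: B *m L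
    = Num.sqrt gamma *: (A - B *m L).
  by rewrite -scalemxAl scalerBr.
have cP := riccati_closed_loop_cost hgamma0 hR hPstab.
have gP := riccati_gain_greedy A hgamma0 hW.
rewrite /gamma_stabilizer -closed in hK0.
rewrite /gamma_stabilizer -closed in sK.
rewrite -hKdef in cP gP sK.
have cP_ k : closed_loop_cost (Num.sqrt gamma *: A) (Num.sqrt gamma *: B) Q R (K_ k) (P_ k).
  move=> v; rewrite {1}(hP k) !bformDm -!bform_congr closed.
  by rewrite sqrt_scaled_congr.
have gP_ k : greedy_gain (Num.sqrt gamma *: A) (Num.sqrt gamma *: B) R (P_ k) (K_ k.+1).
  by rewrite hK; apply: riccati_gain_greedy.
have pdW : pdmx (R + (Num.sqrt gamma *: B)^T *m P *m (Num.sqrt gamma *: B)).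
  case: hassum => [[psdQ pdR _]|[X [_ [hX _ hL _]]]].
    exact: (detectability_weight_pd hPs psdQ pdR cP sK).
  apply: (lmi_weight_pd hR hPs hX cP sK).
  by rewrite !sqrt_scaled_congr.
have [sK_ mono cvgP cvgK] := @policy_iteration _ _ _ (Num.sqrt gamma *: A)
  (Num.sqrt gamma *: B) Q R P K P_ K_ hR hPs hPsym cP gP sK pdW cP_ gP_ hK0.
split; [|exact: mono|exact: cvgP|exact: cvgK].
by move=> k; rewrite -closed; exact: sK_.
Qed.
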